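(* Let $d\ge 2$ and $n$ be positive integers and $N=d^n$. Let $0<\epsilon<0.01$ and assume $n\ge 1/\psi$ where \[ \psi=\frac{\epsilon^2}{400\log^2(1/\epsilon)\, d\log d}. \] Then $\textsf{r}^{\mathbb{C}}_{H_{d,n}}\left(N^{1-\psi}\right)\le N^{\epsilon}$.
   Context: The generalized Walsh–Hadamard matrix $H_{d,n}$ is the $d^n\times d^n$ complex matrix with rows and columns indexed by $I,J\in\mathbb{Z}_d^n$ and entries $\omega^{I\cdot J}$, where $\omega=e^{2\pi i/d}$ and $I\cdot J=\sum_k I^{(k)}J^{(k)}$. For a matrix $M$ over a field $\mathbb{F}$ and real $r$, $\textsf{r}^{\mathbb{F}}_M(r)$ is the smallest $s$ such that $M=A+B$ over $\mathbb{F}$ with $A$ having at most $s$ nonzero entries in each row and column and $\operatorname{rank}(B)\le r$. *)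

(* Defs.v *)
From mathcomp Require Import all_boot all_order all_algebra.
From mathcomp Require Import complex.
From mathcomp Require Import all_classical all_reals all_analysis.

Set Implicit Arguments.
Unset Strict Implicit.
Unset Printing Implicit Defensive.

Import Order.TTheory GRing.Theory Num.Theory.

Local Open Scope ring_scope.

Definition sparse (F : fieldType) (m n : nat) (A : 'M[F]_(m, n)) (s : nat) :=
  (forall i, (#|[set j | A i j != 0%R]%SET| <= s)%N) /\
  (forall j, (#|[set i | A i j != 0%R]%SET| <= s)%N).

Definition rigid_decomposition (F : fieldType) (R : realType) (m n : nat)
    (M : 'M[F]_(m, n)) (r : R) (s : nat) : Prop :=
  exists A B : 'M[F]_(m, n),
    [/\ M = A + B, sparse A s & (\rank B)%:R <= r].

Lemma rigid_decomposition_ex (F : fieldType) (R : realType) (m n : nat)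
    (M : 'M[F]_(m, n)) (r : R) (r_ge0 : 0 <= r) :
  exists s, `[< rigid_decomposition M r s >].
Proof.
exists (m + n)%N; apply/asboolP; exists M, 0.
split; rewrite ?addr0 ?mxrank0 //; split=> k.
- by rewrite (leq_trans (max_card _)) // card_ord leq_addl.
- by rewrite (leq_trans (max_card _)) // card_ord leq_addr.
Qed.

(* For r < 0 no decomposition exists, hence the proof argument. *)
Definition rigidity (F : fieldType) (R : realType) (m n : nat)
    (M : 'M[F]_(m, n)) (r : R) (r_ge0 : 0 <= r) : nat :=
  ex_minn (rigid_decomposition_ex M r_ge0).

Definition omega (R : realType) (d : nat) : R[i] :=
  Complex (cos (2 * pi / d%:R)) (sin (2 * pi / d%:R)).

Definition dotp (d n : nat) (I J : 'rV['Z_d]_n) : 'Z_d :=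
  \sum_(k < n) I 0 k * J 0 k.

(* Matrices are indexed by ordinals, so Z_d^n is enumerated by enum_val.
   'Z_d is the ring of integers mod d only for d >= 2; the exponent is the
   representative in {0, ..., d-1}. *)
Definition walsh_hadamard (R : realType) (d n : nat) :
    'M[R[i]]_(#|{: 'rV['Z_d]_n}|) :=
  \matrix_(i, j) omega R d ^+ (dotp (enum_val i) (enum_val j) : nat).

Lemma card_walsh_hadamard (d n : nat) (hd : (2 <= d)%N) :
  #|{: 'rV['Z_d]_n}| = (d ^ n)%N.
Proof. by rewrite card_mx card_ord mul1n Zp_cast. Qed.

Definition psi (R : realType) (d : nat) (eps : R) : R :=
  eps ^+ 2 / (400 * ln (1 / eps) ^+ 2 * d%:R * ln d%:R).

(* Main.v *)
(**
  Let f(x) = prod_k h(x_k) with h(v) = zeta^(v(v+d)) and zeta = e^(pi i/d).  Since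
  f(I+J) = f(I) f(J) omega^(I.J), the matrix H_{d,n} is, up to invertible diagonal
  scalings, the convolution matrix f(I+J), and the Fourier transform phi of f is a
  function of the occurrence numbers t_c(a) = #{k | a_k = c} of the frequency a.

  Each t_c is the Fourier transform of a function supported on vectors of Hamming
  weight <= 1, so a polynomial of degree m in the t_c is the Fourier transform of a
  function e supported on the Hamming ball of radius m.  Lagrange interpolation
  provides such a polynomial agreeing with phi on every balanced frequency, i.e. one
  whose t_c (c <> 0) all lie within r of n/d, with m <= (d-1) 2r.  Then e(I+J) is
  sparse, because the Hamming ball is small, and (f - e)(I+J) has rank at most the
  number of unbalanced frequencies, which Chernoff bounds control.  The choice
  r = eps n / (6 d log(1/eps)) gives the stated parameters.
*)
Require Import Defs.
From mathcomp Require Import all_boot all_order all_algebra.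
From mathcomp Require Import complex ring lra zify.
From mathcomp Require Import all_classical all_reals all_analysis.

Set Implicit Arguments.
Unset Strict Implicit.
Unset Printing Implicit Defensive.

Import Order.TTheory GRing.Theory Num.Theory.

Local Open Scope ring_scope.

Lemma sum_prod_row (K : comPzSemiRingType) (I : finType) (n : nat)
    (F : 'I_n -> I -> K) :
  \sum_(a : 'rV[I]_n) \prod_k F k (a 0 k) = \prod_k \sum_z F k z.
Proof.
rewrite bigA_distr_bigA /=.
rewrite (reindex (fun f : {ffun 'I_n -> I} => \row_k f k)) /=; last first.
  exists (fun a : 'rV_n => [ffun k => a 0 k]) => [f _|a _].
    by apply/ffunP => k; rewrite ffunE mxE.
  by apply/rowP => k; rewrite mxE ffunE.
by apply: eq_bigr => f _; apply: eq_bigr => k _; rewrite mxE.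
Qed.

(** * Characters of [Z_d^n] and Fourier transforms of functions of low Hamming weight *)

Section Fourier.

Variables (C : fieldType) (d n : nat) (w : C).
Hypotheses (d_gt1 : (1 < d)%N) (w_prim : d.-primitive_root w).

Local Notation T := ('rV['Z_d]_n).

Definition chi (z : 'Z_d) : C := w ^+ z.

Lemma chi0 : chi 0 = 1. Proof. by []. Qed.

Lemma chiD (x y : 'Z_d) : chi (x + y) = chi x * chi y.
Proof.
rewrite /chi; have -> : nat_of_ord (x + y) = ((x + y) %% d)%N.
  by rewrite -[X in (_ %% X)%N](Zp_cast d_gt1).
by rewrite prim_expr_mod // exprD.
Qed.

Lemma chi_sum (I : Type) (r : seq I) (P : pred I) (F : I -> 'Z_d) :
  chi (\sum_(i <- r | P i) F i) = \prod_(i <- r | P i) chi (F i).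
Proof. exact: (big_morph chi chiD chi0). Qed.

Lemma chi_eq1 (z : 'Z_d) : (chi z == 1) = (z == 0).
Proof.
rewrite /chi -(prim_order_dvd w_prim) -val_eqE /=.
have zd : (z < d)%N by rewrite -[X in (_ < X)%N](Zp_cast d_gt1).
by rewrite /dvdn modn_small.
Qed.

(** Shifting [c] by 1 multiplies the sum by [chi z], so the sum vanishes unless [chi z = 1], that
    is, unless [z = 0]. *)
Lemma sum_chi (z : 'Z_d) : \sum_c chi (c * z) = (z == 0)%:R * d%:R.
Proof.
have [->|z0] := eqVneq z 0.
  under eq_bigr do rewrite mulr0 chi0.
  by rewrite sumr_const card_ord Zp_cast // mul1r.
rewrite mul0r; apply/eqP.
have : (chi z - 1) * \sum_c chi (c * z) == 0.
  rewrite mulrBl mul1r subr_eq0 mulr_sumr.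
  rewrite [in eqbRHS](reindex_inj (addrI (1 : 'Z_d))) /=; apply/eqP.
  by apply: eq_bigr => c _; rewrite mulrDl mul1r chiD.
by rewrite mulf_eq0 subr_eq0 chi_eq1 (negPf z0).
Qed.

Lemma dotpDr (a x y : T) : dotp a (x + y) = dotp a x + dotp a y.
Proof. by rewrite /dotp -big_split; apply: eq_bigr => k _; rewrite mxE mulrDr. Qed.

Lemma chi_dotp (a x : T) : chi (dotp a x) = \prod_k chi (a 0 k * x 0 k).
Proof. exact: chi_sum. Qed.

Lemma sum_chi_dotp (x : T) :
  \sum_a chi (dotp a x) = (x == 0)%:R * (d ^ n)%N%:R.
Proof.
under eq_bigr do rewrite chi_dotp.
rewrite (sum_prod_row (fun k z => chi (z * x 0 k))).
under eq_bigr do rewrite sum_chi.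
rewrite big_split /= prodr_const card_ord natrX; congr (_ * _).
have [->|x0] := eqVneq x 0.
  by rewrite big1 // => k _; rewrite mxE eqxx.
apply/eqP/prodf_eq0; have [k xk] : exists k, x 0 k != 0.
  apply/existsP; apply: contraR x0; rewrite negb_exists => /forallP h.
  by apply/eqP/rowP => k; rewrite mxE; apply/eqP; have := h k; rewrite negbK.
by exists k => //; rewrite (negPf xk).
Qed.

Definition hamming (x : T) : nat := #|[set k | x 0 k != 0]%SET|.

Lemma hammingD (x y : T) : (hamming (x + y) <= hamming x + hamming y)%N.
Proof.
apply: leq_trans (leq_card_setU _ _).
apply/subset_leq_card/fintype.subsetP => k; rewrite !inE mxE.
by apply: contraR; rewrite negb_or !negbK => /andP[/eqP-> /eqP->]; rewrite addr0.
Qed.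

(** This plays the role of having degree at most [m]: constants have degree 0, occurrence numbers
    have degree 1, sums and scalings preserve the bound, and products add it. *)
Definition low_weight_ft (m : nat) (Phi : T -> C) : Prop :=
  exists e : T -> C, (forall x, (m < hamming x)%N -> e x = 0) /\
    forall a, Phi a = \sum_x e x * chi (dotp a x).

Lemma low_weight_ft_ext m Phi Psi : Phi =1 Psi ->
  low_weight_ft m Phi -> low_weight_ft m Psi.
Proof. by move=> eqP [e [e0 eE]]; exists e; split=> // a; rewrite -eqP. Qed.

Lemma low_weight_ft_chi m x : (hamming x <= m)%N ->
  low_weight_ft m (fun a => chi (dotp a x)).
Proof.
move=> hx; exists (fun y => (y == x)%:R); split=> [y|a].
  by have [->|//] := eqVneq y x; rewrite ltnNge hx.
rewrite (bigD1 x) //= eqxx mul1r big1 ?addr0 // => y /negPf->.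
by rewrite mul0r.
Qed.

Lemma low_weight_ftZ m c Phi :
  low_weight_ft m Phi -> low_weight_ft m (fun a => c * Phi a).
Proof.
move=> [e [e0 eE]]; exists (fun x => c * e x); split=> [x hx|a].
  by rewrite e0 // mulr0.
by rewrite eE mulr_sumr; under eq_bigr do rewrite mulrA.
Qed.

Lemma low_weight_ftD m Phi Psi : low_weight_ft m Phi -> low_weight_ft m Psi ->
  low_weight_ft m (fun a => Phi a + Psi a).
Proof.
move=> [e [e0 eE]] [f [f0 fE]]; exists (fun x => e x + f x); split=> [x hx|a].
  by rewrite e0 // f0 // addr0.
by rewrite eE fE -big_split; under [RHS]eq_bigr do rewrite mulrDl.
Qed.

Lemma low_weight_ft_sum m (I : Type) (r : seq I) (P : pred I)
    (Phi : I -> T -> C) : (forall i, P i -> low_weight_ft m (Phi i)) ->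
  low_weight_ft m (fun a => \sum_(i <- r | P i) Phi i a).
Proof.
move=> h; elim: r => [|i r IH].
  exists (fun=> 0); split=> // a; rewrite big_nil big1 // => x _.
  by rewrite mul0r.
case Pi : (P i); last first.
  by apply: low_weight_ft_ext IH => a; rewrite big_cons Pi.
apply: low_weight_ft_ext (low_weight_ftD (h i Pi) IH) => a.
by rewrite big_cons Pi.
Qed.

Lemma dotp0 (a : T) : dotp a 0 = 0.
Proof. by rewrite /dotp big1 // => k _; rewrite mxE mulr0. Qed.

Lemma hamming0 : hamming 0 = 0%N.
Proof. by apply: eq_card0 => k; rewrite !inE mxE eqxx. Qed.

Lemma low_weight_ft_cst m c : low_weight_ft m (fun=> c).
Proof.
have h : low_weight_ft m (fun a => chi (dotp a 0)).
  by apply: low_weight_ft_chi; rewrite hamming0.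
apply: low_weight_ft_ext (low_weight_ftZ c h) => a.
by rewrite dotp0 chi0 mulr1.
Qed.

(** A product of transforms is the transform of the convolution, and Hamming weight is
    subadditive. *)
Lemma low_weight_ftM m m' Phi Psi : low_weight_ft m Phi -> low_weight_ft m' Psi ->
  low_weight_ft (m + m') (fun a => Phi a * Psi a).
Proof.
move=> [e [e0 eE]] [f [f0 fE]].
exists (fun z => \sum_x e x * f (z - x)); split=> [z hz|a].
  rewrite big1 // => x _.
  have [hx|hx] := ltnP m (hamming x); first by rewrite e0 // mul0r.
  rewrite f0 ?mulr0 //.
  have := hammingD x (z - x); rewrite [x + _]addrC subrK => hz'.
  rewrite ltnNge; apply: contraL hz => hx'.
  by rewrite -leqNgt (leq_trans hz') // leq_add.
under [RHS]eq_bigr do rewrite mulr_suml.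
rewrite exchange_big eE mulr_suml; apply: eq_bigr => x _ /=.
rewrite fE mulr_sumr [RHS](reindex_inj (addIr x)) /=; apply: eq_bigr => y _.
by rewrite addrK dotpDr chiD; ring.
Qed.

Lemma low_weight_ft_prod m (I : Type) (r : seq I) (P : pred I)
    (Phi : I -> T -> C) : (forall i, P i -> low_weight_ft m (Phi i)) ->
  low_weight_ft (count P r * m) (fun a => \prod_(i <- r | P i) Phi i a).
Proof.
move=> h; elim: r => [|i r IH] /=.
  by apply: low_weight_ft_ext (low_weight_ft_cst _ 1) => a; rewrite big_nil.
case Pi : (P i); last first.
  by apply: low_weight_ft_ext IH => a; rewrite big_cons Pi.
rewrite mulSn; apply: low_weight_ft_ext (low_weight_ftM (h i Pi) IH) => a.
by rewrite big_cons Pi.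
Qed.

Definition occ (a : T) (c : 'Z_d) : nat := #|[set k | a 0 k == c]%SET|.

(** By orthogonality the indicator of [a_k = c] is the average over [z] of [chi (z * (a_k - c))].
    Each term is a multiple of the character of a vector supported on the single coordinate [k]. *)
Lemma low_weight_ft_occ c : low_weight_ft 1 (fun a => (occ a c)%:R).
Proof.
have d0 : d%:R != 0 :> C := prim_root_natf_neq0 w_prim.
pose u k z : T := \row_j (if j == k then z else 0).
have dotu a k z : dotp a (u k z) = a 0 k * z.
  rewrite /dotp (bigD1 k) //= mxE eqxx big1 ?addr0 // => j /negPf jk.
  by rewrite mxE jk mulr0.
have hu k z : (hamming (u k z) <= 1)%N.
  rewrite -(cards1 k); apply/subset_leq_card/fintype.subsetP => j.
  by rewrite !inE mxE; case: (j == k) => //; rewrite eqxx.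
apply: (@low_weight_ft_ext _ (fun a => \sum_k \sum_z
   (d%:R^-1 * chi (- (z * c))) * chi (dotp a (u k z)))); last first.
  apply: low_weight_ft_sum => k _; apply: low_weight_ft_sum => z _.
  exact/low_weight_ftZ/low_weight_ft_chi.
move=> a; rewrite /occ -sum1_card natr_sum [RHS]big_mkcond /=.
apply: eq_bigr => k _; rewrite inE.
under eq_bigr => z _ do rewrite dotu -mulrA -chiD (mulrC (a 0 k)) addrC -mulrBr.
rewrite -mulr_sumr sum_chi subr_eq0.
by case: (_ == _); rewrite ?mul0r ?mulr0 // mul1r mulVf.
Qed.

End Fourier.

(** * Interpolation on balanced frequencies and the sparse plus low-rank splitting *)

Section Decomposition.

Variables (C : numFieldType) (d n : nat) (w : C).
Hypotheses (d_gt1 : (1 < d)%N) (w_prim : d.-primitive_root w).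

Local Notation T := ('rV['Z_d]_n).

(* The value at 0 is erased: it is determined by the others, and erasing it leaves
   d - 1 variables to interpolate in. *)
Definition profile (a : T) : {ffun 'Z_d -> nat} :=
  [ffun c => if c == 0 then 0%N else occ a c].

Definition balanced (S : seq nat) (a : T) : bool :=
  [forall c, (c != 0) ==> (occ a c \in S)].

(** Multivariate Lagrange interpolation on the grid of values in [S]: there are [d.-1] variables,
    and each basis polynomial has degree [(size S).-1] in each of them. *)
Lemma interpolate_profile (F : {ffun 'Z_d -> nat} -> C) (S : seq nat) :
  uniq S -> exists P : T -> C, low_weight_ft w (d.-1 * (size S).-1) P /\
    forall a, balanced S a -> P a = F (profile a).
Proof.
move=> uS.
pose fac (t : {ffun 'Z_d -> nat}) c s (a : T) : C :=
  ((t c)%:R - s%:R)^-1 * ((occ a c)%:R + - s%:R).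
pose L (t : {ffun 'Z_d -> nat}) (a : T) :=
  \prod_(c | c != 0) \prod_(s <- S | s != t c) fac t c s a.
(* Only profiles of balanced vectors serve as nodes, so [t c] lies in [S] and exactly one factor per
   [c] is omitted from [L t]. The condition [t \in r] in the sum below keeps this fact available
   termwise. *)
pose r := undup [seq profile b | b <- enum (balanced S)].
exists (fun a => \sum_(t <- r | t \in r) F t * L t a); split.
  apply: low_weight_ft_sum => t; rewrite mem_undup => /mapP[b].
  rewrite mem_enum => /forallP bS ->.
  apply: low_weight_ftZ; rewrite /L.
  have -> : d.-1 = count (fun c : 'Z_d => c != 0) (index_enum 'Z_d).
    rewrite -sum1_count -[in LHS](Zp_cast d_gt1).
    by have := cardC1 (0 : 'Z_d); rewrite card_ord -sum1_card => <-.
  apply: low_weight_ft_prod => // c c0.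
  have -> : (size S).-1 = (count (fun s => s != profile b c) S * 1)%N.
    rewrite muln1 ffunE (negPf c0) -(count_predC (pred1 (occ b c)) S).
    by rewrite count_uniq_mem // (implyP (bS c)).
  apply: low_weight_ft_prod => // s _; apply: low_weight_ftZ.
  by apply: low_weight_ftD; [exact: low_weight_ft_occ | exact: low_weight_ft_cst].
move=> a aS; have ar : profile a \in r.
  by rewrite mem_undup map_f // mem_enum.
rewrite -big_seq (bigD1_seq (profile a)) ?undup_uniq //=.
rewrite [X in _ * X + _](_ : _ = 1) => [|].
  rewrite mulr1 big_seq_cond big1 ?addr0 // => t /andP[tr ta].
  have [c] : exists c, t c != profile a c.
    by apply/existsP; apply: contraR ta; rewrite negb_exists => /forallP h;
       apply/eqP/ffunP => c; apply/eqP; have := h c; rewrite negbK.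
  have [b bS tb] : exists2 b, balanced S b & t = profile b.
    by move: tr; rewrite mem_undup => /mapP[b]; rewrite mem_enum; exists b.
  (* Both profiles vanish at 0, so they differ at some [c != 0]. There the factor of [L t] with
     [s = occ a c] is zero. *)
  have [->|c0] := eqVneq c 0; first by rewrite tb !ffunE eqxx.
  rewrite [profile a c]ffunE (negPf c0) => tc.
  rewrite /L (bigD1 c) //= (_ : \prod_(s <- S | _) _ = 0) ?mul0r ?mulr0 //.
  apply/eqP; rewrite prodf_seq_eq0; apply/hasP; exists (occ a c).
    exact: (implyP (forallP aS c)).
  by rewrite eq_sym tc /fac subrr mulr0 eqxx.
rewrite /L big1 // => c c0; rewrite big1 // => s.
rewrite ffunE (negPf c0) => sc; rewrite /fac ffunE (negPf c0) mulVf //.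
by rewrite subr_eq0 eqr_nat eq_sym.
Qed.

(** The occurrences of all values add up to [n], which recovers the exponent of [eta 0]. The
    right-hand side is kept as an explicit function applied to [profile a], the shape that
    interpolation expects. *)
Lemma prod_profile (eta : 'Z_d -> C) (a : T) :
  \prod_k eta (a 0 k) =
  (fun t : {ffun 'Z_d -> nat} => eta 0 ^+ (n - \sum_(c | c != 0) t c) *
    \prod_(c | c != 0) eta c ^+ t c) (profile a).
Proof.
rewrite (partition_big (fun k => a 0 k) predT) //= (bigD1 0) //=.
have E c : \prod_(k | a 0 k == c) eta (a 0 k) = eta c ^+ occ a c.
  under eq_bigr => k /eqP-> do over.
  by rewrite prodr_const; congr (_ ^+ _); apply: eq_card => k; rewrite !inE.
have -> : (n - \sum_(c : 'Z_d | c != 0%R) profile a c = occ a 0%R)%N.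
  have -> : (\sum_(c : 'Z_d | c != 0%R) profile a c =
             \sum_(c : 'Z_d | c != 0%R) occ a c)%N.
    by apply: eq_bigr => c c0; rewrite ffunE (negPf c0).
  suff {1}-> : (n = occ a 0%R + \sum_(c : 'Z_d | c != 0%R) occ a c)%N
    by rewrite addnK.
  rewrite -[LHS]card_ord -sum1_card (partition_big (fun k => a 0 k) predT) //=.
  rewrite (bigD1 0) //=; congr addn; first by rewrite sum1dep_card.
  by apply: eq_bigr => c _; rewrite sum1dep_card.
rewrite E; congr (_ * _); apply: eq_bigr => c c0.
by rewrite E ffunE (negPf c0).
Qed.

Lemma fourier_Zd (h : 'Z_d -> C) :
  exists eta : 'Z_d -> C, forall x, h x = \sum_c eta c * chi w (c * x).
Proof.
have d0 : d%:R != 0 :> C := prim_root_natf_neq0 w_prim.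
exists (fun c => d%:R^-1 * \sum_y h y * chi w (- (c * y))) => x.
transitivity (d%:R^-1 * \sum_y h y * \sum_c chi w (c * (x - y))).
  rewrite (bigD1 x) //= [X in _ + X]big1 => [|y yx].
    by rewrite addr0 sum_chi // subrr eqxx mul1r mulrCA mulVf // mulr1.
  by rewrite sum_chi // subr_eq0 eq_sym (negPf yx) mul0r mulr0.
under eq_bigr do rewrite mulr_sumr.
rewrite exchange_big mulr_sumr; apply: eq_bigr => c _ /=.
rewrite -mulrA mulr_suml; congr (_ * _); apply: eq_bigr => y _.
by rewrite -mulrA -chiD // mulrBr addrC.
Qed.

(* The factor z^(x d) makes x |-> z^(x^2) d-periodic also when d is odd. *)
Lemma gauss_twist (z : C) : z ^+ 2 = w -> exists h : 'Z_d -> C,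
  (forall x, h x != 0) /\ forall x y, h (x + y) = h x * h y * chi w (x * y).
Proof.
move=> z2; pose g v := z ^+ (v * (v + d)).
have z2d : z ^+ (2 * d) = 1 by rewrite exprM z2 prim_expr_order.
have gD v : g (v + d)%N = g v.
  rewrite /g (_ : (_ * _ = v * (v + d) + 2 * d * (v + d))%N); last by ring.
  by rewrite exprD [X in _ * X]exprM z2d expr1n mulr1.
have g_mod v : g (v %% d)%N = g v.
  rewrite [in RHS](divn_eq v d) addnC; elim: (v %/ d)%N => [|q IH].
    by rewrite mul0n addn0.
  by rewrite mulSn addnCA addnC gD.
have z0 : z != 0.
  apply: contraTneq isT => z0; move: z2d; rewrite z0 expr0n muln_eq0 /=.
  by rewrite (gtn_eqF (ltnW d_gt1)) => /eqP; rewrite eq_sym oner_eq0.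
exists (fun x => g x); split=> [x|x y]; first exact: expf_neq0.
have -> : nat_of_ord (x + y) = ((x + y) %% d)%N.
  by rewrite -[X in (_ %% X)%N](Zp_cast d_gt1).
rewrite g_mod /chi; have -> : nat_of_ord (x * y) = ((x * y) %% d)%N.
  by rewrite -[X in (_ %% X)%N](Zp_cast d_gt1).
rewrite prim_expr_mod // -z2 -exprM -!exprD /g.
rewrite (_ : (_ * _ = x * (x + d) + y * (y + d) + 2 * (x * y))%N) //; ring.
Qed.

Lemma walsh_hadamard_decomposition (z : C) (S : seq nat)
    (M : 'M[C]_(#|{: 'rV['Z_d]_n}|)) :
    z ^+ 2 = w -> uniq S ->
    (forall i j, M i j = chi w (dotp (enum_val i) (enum_val j))) ->
  exists A B : 'M[C]_(#|{: 'rV['Z_d]_n}|),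
    [/\ M = A + B,
        sparse A #|[set x : T | (hamming x <= d.-1 * (size S).-1)%N]%SET| &
        (\rank B <= #|[set a : T | ~~ balanced S a]%SET|)%N].
Proof.
move=> z2 uS ME.
have [h [h0 hD]] := gauss_twist z2.
have [eta etaE] := fourier_Zd h.
pose f (x : T) := \prod_k h (x 0 k).
pose phi (a : T) := \prod_k eta (a 0 k).
have f0 x : f x != 0 by apply/prodf_neq0 => k _; exact: h0.
have fD x y : f (x + y) = f x * f y * chi w (dotp x y).
  rewrite chi_dotp // -!big_split; apply: eq_bigr => k _ /=.
  by rewrite mxE hD.
have fE x : f x = \sum_a phi a * chi w (dotp a x).
  rewrite /f; under eq_bigr do rewrite etaE.
  rewrite -(sum_prod_row (fun k c => eta c * chi w (c * x 0 k))).
  by apply: eq_bigr => a _; rewrite big_split chi_dotp.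
have [P [[e [e0 PE]] PS]] := interpolate_profile
  (fun t : {ffun 'Z_d -> nat} => eta 0 ^+ (n - \sum_(c | c != 0) t c) *
    \prod_(c | c != 0) eta c ^+ t c) uS.
have phiS a : balanced S a -> phi a - P a = 0.
  by move=> aS; rewrite PS // /phi prod_profile subrr.
(* Applying the transform twice with the same sign in the character reflects the argument, hence
   [e (- x)]. *)
have Pinv x : \sum_a P a * chi w (dotp a x) = (d ^ n)%N%:R * e (- x).
  under eq_bigr do rewrite PE mulr_suml.
  rewrite exchange_big (bigD1 (- x)) //= addrC big1 ?add0r => [|y yx].
    under eq_bigr do rewrite -mulrA -chiD // -dotpDr addNr.
    by rewrite -mulr_sumr sum_chi_dotp // eqxx mul1r mulrC.
  under eq_bigr do rewrite -mulrA -chiD // -dotpDr.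
  by rewrite -mulr_sumr sum_chi_dotp // addr_eq0 (negPf yx) mul0r mulr0.
pose U := [set a : T | ~~ balanced S a]%SET.
pose A : 'M[C]_(#|{: 'rV['Z_d]_n}|) := \matrix_(i, j)
  ((f (enum_val i))^-1 * (f (enum_val j))^-1 *
   ((d ^ n)%N%:R * e (- (enum_val i + enum_val j)))).
(* Since [phi - P] vanishes on balanced frequencies and characters split over [x + y], the remainder
   factors through the index set [U], which bounds its rank. *)
pose B1 : 'M[C]_(#|{: 'rV['Z_d]_n}|, #|U|) := \matrix_(i, k)
  ((f (enum_val i))^-1 * (phi (enum_val k) - P (enum_val k)) *
    chi w (dotp (enum_val k) (enum_val i))).
pose B2 : 'M[C]_(#|U|, #|{: 'rV['Z_d]_n}|) := \matrix_(k, j)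
  ((f (enum_val j))^-1 * chi w (dotp (enum_val k) (enum_val j))).
have AC i j : A i j = A j i by rewrite !mxE addrC [_^-1 * _]mulrC.
have As i : (#|[set j | A i j != 0%R]%SET| <=
    #|[set x : T | (hamming x <= d.-1 * (size S).-1)%N]%SET|)%N.
  (* For a fixed row this map is injective and sends the nonzero positions into the Hamming ball.
     Columns follow from the symmetry [AC]. *)
  rewrite -(@card_in_imset _ _ (fun j => - (enum_val i + enum_val j))).
    apply/subset_leq_card/fintype.subsetP => x /imsetP[j].
    rewrite !inE mxE => Aij ->; rewrite leqNgt; apply: contra Aij => hx.
    by rewrite e0 // !mulr0.
  by move=> j k _ _ /oppr_inj /addrI /enum_val_inj.
exists A, (B1 *m B2); split; last exact: mulmx_max_rank.
- apply/matrixP => i j; rewrite ME mxE [A i j]mxE mxE.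
  set x := enum_val i; set y := enum_val j.
  under eq_bigr => k _ do rewrite 2!mxE -/x -/y.
  have -> : chi w (dotp x y) = (f x)^-1 * (f y)^-1 * f (x + y).
    by rewrite fD; field; rewrite !f0.
  have -> : f (x + y) = (d ^ n)%N%:R * e (- (x + y)) +
      \sum_a (phi a - P a) * chi w (dotp a (x + y)).
    rewrite -Pinv fE -big_split; apply: eq_bigr => a _ /=.
    by rewrite -mulrDl [P a + _]addrC subrK.
  rewrite mulrDr; congr (_ + _).
  rewrite (bigID (mem U)) /= [X in _ + X]big1 ?addr0 => [|a]; last first.
    by rewrite inE negbK => aS; rewrite phiS // mul0r.
  rewrite big_enum_val mulr_sumr; apply: eq_bigr => k _.
  by rewrite dotpDr chiD //; ring.
- by split=> // j; under eq_finset do rewrite AC.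
Qed.

End Decomposition.

(** * Exponential-moment bounds for Hamming balls and occurrence numbers *)

Section Counting.

Variables (R : realType) (d n : nat).
Hypothesis d_gt1 : (1 < d)%N.

Local Notation T := ('rV['Z_d]_n).

(** Markov's inequality for the counting measure. *)
Lemma card_le_sum (E : {set T}) (g : T -> R) (y : R) : 0 < y ->
  (forall a, 0 <= g a) -> (forall a, a \in E -> y <= g a) ->
  #|E|%:R <= y^-1 * \sum_a g a.
Proof.
move=> y0 g0 gE; rewrite mulrC ler_pdivlMr //.
rewrite mulrC mulr_natr -sumr_const [leRHS](bigID (mem E)) /=.
rewrite ler_wpDr ?sumr_ge0 //; exact: ler_sum.
Qed.

Lemma sum_if_eq (c : 'Z_d) (u v : R) :
  \sum_z (if z == c then u else v) = u + d.-1%:R * v.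
Proof.
rewrite (bigD1 c) //= eqxx; congr (_ + _).
rewrite (eq_bigr (fun=> v)) => [|z /negPf->] //.
by rewrite sumr_const cardC1 card_ord Zp_cast // mulr_natl.
Qed.

(** Give [x] the weight [q ^+ hamming x]. The total weight factors over coordinates, and each point
    of the ball weighs at least [q ^+ m] because [q <= 1]. *)
Lemma card_hamming_ball (m : nat) (q : R) : 0 < q -> q <= 1 ->
  #|[set x : T | (hamming x <= m)%N]%SET|%:R <=
    (q ^+ m)^-1 * (1 + d.-1%:R * q) ^+ n.
Proof.
move=> q0 q1.
have -> : (1 + d.-1%:R * q) ^+ n = \sum_(x : T) q ^+ hamming x.
  transitivity (\sum_(x : T) \prod_k (if x 0 k == 0 then 1 else q)).
    rewrite (sum_prod_row (fun k z => if z == 0 then 1 else q)).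
    by under eq_bigr do rewrite sum_if_eq; rewrite prodr_const card_ord.
  apply: eq_bigr => x _; rewrite /hamming -prodr_const [RHS]big_mkcond.
  by apply: eq_bigr => k _; rewrite inE; case: eqP.
apply: card_le_sum; rewrite ?exprn_gt0 // => x; first by rewrite exprn_ge0 // ltW.
by rewrite inE => hx; rewrite ler_wiXn2l // ltW.
Qed.

(** The same argument with weight [expR (mu * occ a c)]. The sign of [mu] is free, so that both
    tails are covered. *)
Lemma card_occ_tail (c : 'Z_d) (mu y : R) :
  #|[set a : T | y <= mu * (occ a c)%:R]%SET|%:R <=
  (expR y)^-1 * (expR mu + d.-1%:R) ^+ n.
Proof.
have -> : (expR mu + d.-1%:R) ^+ n = \sum_(a : T) expR (mu * (occ a c)%:R).
  transitivity (\sum_(x : T) \prod_k (if x 0 k == c then expR mu else 1)).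
    rewrite (sum_prod_row (fun k z => if z == c then expR mu else 1)).
    by under eq_bigr do rewrite sum_if_eq mulr1; rewrite prodr_const card_ord.
  apply: eq_bigr => x _; rewrite expRM_natr /occ -prodr_const [RHS]big_mkcond.
  by apply: eq_bigr => k _; rewrite inE; case: eqP.
apply: card_le_sum; rewrite ?expR_gt0 // => a.
by rewrite inE ler_expR.
Qed.

(* expR x = expR (x / 2) ^ 2 <= (1 - x / 2)^-2 = 1 + x + 3/4 x^2 + O(x^3). *)
Lemma expR_le_quadratic (x : R) : `|x| <= 1 / 5 ->
  expR x <= 1 + x + 9 / 10 * x ^+ 2.
Proof.
rewrite ler_norml => /andP[x1 x2].
have h : (1 - x / 2) ^+ 2 * expR x <= 1.
  have -> : expR x = expR (x / 2) ^+ 2 by rewrite -expRM_natr; congr expR; field.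
  rewrite -exprMn expr_le1 //; last by rewrite mulr_ge0 ?expR_ge0 //; lra.
  rewrite -[x / 2]opprK expRN ler_pdivrMr ?expR_gt0 // mul1r opprK.
  exact: expR_ge1Dx.
rewrite -(ler_pM2l (_ : 0 < (1 - x / 2) ^+ 2)); last by rewrite exprn_gt0 //; lra.
apply: le_trans h _; rewrite -subr_ge0.
rewrite (_ : _ - _ = x ^+ 2 * (3 / 20 - 13 / 20 * x + 9 / 40 * x ^+ 2));
  last by field.
by rewrite mulr_ge0 ?sqr_ge0 //; have := sqr_ge0 x; lra.
Qed.

(* lam minimises the Chernoff exponent 9/10 lam^2 n/d - lam r. *)
Lemma card_occ_deviation (c : 'Z_d) (r lam : R) : (0 < n)%N ->
  lam = r * d%:R / (9 / 5 * n%:R) -> 0 <= r -> lam <= 1 / 5 ->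
  #|[set a : T | r < `|(occ a c)%:R - n%:R / d%:R|]%SET|%:R <=
   2 * d%:R ^+ n * expR (- (r ^+ 2 * d%:R / (18 / 5 * n%:R))).
Proof.
move=> n0 lamE r0 lam5.
have D0 : 0 < d%:R :> R by rewrite ltr0n ltnW.
have N0 : 0 < n%:R :> R by rewrite ltr0n.
have lam0 : 0 <= lam by rewrite lamE divr_ge0 ?mulr_ge0 ?ler0n //; lra.
(* Taking [mu = lam] bounds the upper tail and [mu = - lam] the lower one. *)
have key mu : `|mu| = lam ->
  #|[set a : T | lam * r + mu * (n%:R / d%:R) <= mu * (occ a c)%:R]%SET|%:R <=
   d%:R ^+ n * expR (- (r ^+ 2 * d%:R / (18 / 5 * n%:R))).
  move=> mulam; apply: le_trans (card_occ_tail _ _ _) _.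
  have h1 : expR mu + d.-1%:R <= d%:R * expR ((mu + 9 / 10 * lam ^+ 2) / d%:R).
    have lam2 : lam ^+ 2 = mu ^+ 2 by rewrite -mulam real_normK ?num_real.
    have h : expR mu <= 1 + mu + 9 / 10 * mu ^+ 2.
      by apply: expR_le_quadratic; rewrite mulam.
    have := expR_ge1Dx ((mu + 9 / 10 * mu ^+ 2) / d%:R).
    rewrite -(ler_pM2l D0) mulrDr mulr1 mulrCA mulfV ?gt_eqF // mulr1.
    have -> : (d.-1%:R : R) = d%:R - 1 by rewrite -subn1 natrB // ltnW.
    by rewrite lam2; lra.
  apply: le_trans (_ : (expR (lam * r + mu * (n%:R / d%:R)))^-1 *
    (d%:R * expR ((mu + 9 / 10 * lam ^+ 2) / d%:R)) ^+ n <= _).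
    rewrite ler_wpM2l ?invr_ge0 ?expR_ge0 // lerXn2r // nnegrE.
      by rewrite addr_ge0 ?expR_ge0.
    by rewrite mulr_ge0 ?expR_ge0 // ltW.
  rewrite exprMn -expRM_natr -expRN mulrCA -expRD ler_pM2l ?exprn_gt0 //.
  rewrite ler_expR lamE le_eqVlt; apply/orP; left; apply/eqP; field.
  by rewrite !gt_eqF.
have := key lam (ger0_norm lam0); have := key (- lam).
rewrite normrN => /(_ (ger0_norm lam0)); set E1 := [set a | _]%SET => k1.
set E2 := [set a | _]%SET => k2.
apply: le_trans (_ : #|(E1 :|: E2)%SET|%:R <= _).
  rewrite ler_nat; apply/subset_leq_card/fintype.subsetP => a.
  rewrite !inE lter_normr => /orP[] h; apply/orP; [right|left].
    rewrite -mulrDr ler_wpM2l //; lra.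
  rewrite !mulNr -mulrN -mulrN -mulrDr ler_wpM2l //; lra.
apply: le_trans (_ : (#|E1| + #|E2|)%:R <= _).
  by rewrite ler_nat leq_card_setU.
by rewrite natrD -mulrA mulr_natl mulr2n lerD.
Qed.

End Counting.

(** * Primitivity of [omega] *)

Lemma complex_cos_sin_expr (R : realType) (t : R) (k : nat) :
  (Complex (cos t) (sin t)) ^+ k = Complex (cos (t * k%:R)) (sin (t * k%:R)).
Proof.
elim: k => [|k IH]; first by rewrite expr0 mulr0 cos0 sin0.
rewrite exprSr IH -natr1 mulrDr mulr1 cosD sinD.
by apply/eqP; rewrite eq_complex /= eqxx addrC /=; apply/eqP; ring.
Qed.

Lemma omega_prim (R : realType) (d : nat) : (1 < d)%N ->
  d.-primitive_root (omega R d).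
Proof.
move=> d1; have d0 : (0 < d)%N by apply: ltnW.
have D0 : 0 < d%:R :> R by rewrite ltr0n.
apply/andP; split=> //; apply/forallP => k; apply/eqP; rewrite unity_rootE.
rewrite /omega complex_cos_sin_expr eq_complex /=.
have [->|kd] := eqVneq k.+1 d.
  rewrite (_ : 2 * pi / d%:R * d%:R = pi *+ 2); last first.
    by rewrite -mulr_natl; field; rewrite gt_eqF.
  by rewrite cos2pi sin2pi !eqxx.
(* The real part already differs from 1: it is [1 - 2 sin^2 t] with [t = pi (k+1) / d] strictly
   between 0 and [pi]. *)
apply/negbTE; rewrite negb_and; apply/orP; left.
rewrite (_ : 2 * pi / d%:R * k.+1%:R = (pi / d%:R * k.+1%:R) *+ 2); last first.
  by rewrite -mulr_natl; ring.
rewrite cos_mulr2n cos2sin2.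
have : 0 < sin (pi / d%:R * k.+1%:R : R).
  apply: sin_gt0_pi; rewrite !mulr_gt0 ?invr_gt0 ?pi_gt0 ?ltr0n //=.
  rewrite -mulrA gtr_pMr ?pi_gt0 // mulrC ltr_pdivrMr // mul1r ltr_nat.
  by rewrite ltn_neqAle kd ltn_ord.
move=> s0; rewrite lt_eqF //.
by have := exprn_gt0 2 s0; rewrite -mulr_natl; lra.
Qed.

(** * Numerical estimates and choice of parameters *)

Lemma size_uniq_near (R : realType) (S : seq nat) (x r : R) : 0 <= r -> uniq S ->
  (forall s, s \in S -> `|s%:R - x| <= r) -> (size S).-1%:R <= 2 * r.
Proof.
move=> r0 uS Sr.
have [S0|S0] := posnP (size S); first by rewrite S0 mulr_ge0.
have exS : exists s, s \in S by exists (nth 0%N S 0); rewrite mem_nth.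
have [lo loS lo_min] := ex_minnP exS.
have two_r : 0 <= 2 * r by rewrite mulr_ge0.
(* All elements lie between the least one [lo] and [lo + 2 r], hence in an integer interval of
   [truncn (2 * r) + 1] elements. The predecessor of the size removes the 1. *)
apply: le_trans (_ : (Num.truncn (2 * r))%:R <= _); last by rewrite truncn_le.
rewrite ler_nat -ltnS prednK // -[X in (_ <= X)%N](size_iota lo).
apply: uniq_leq_size => // s sS.
have los := lo_min _ sS.
rewrite mem_iota los addnS ltnS -leq_subLR truncn_ge_nat // natrB //.
by have := Sr _ sS; have := Sr _ loS; rewrite !ler_norml; lra.
Qed.

(** A union bound over the [d - 1] nonzero values [c]. The resulting factor [2 (d - 1)] is coarsened
    to [d ^ 2], a pure power of [d]. *)
Lemma card_unbalanced (R : realType) (d n : nat) (S : seq nat) (r lam : R) :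
  (1 < d)%N -> (0 < n)%N -> 0 <= r ->
  lam = r * d%:R / (9 / 5 * n%:R) -> lam <= 1 / 5 ->
  (forall s : nat, (s <= n)%N -> `|s%:R - n%:R / d%:R| <= r -> s \in S) ->
  #|[set a : 'rV['Z_d]_n | ~~ balanced S a]%SET|%:R <=
  d%:R ^+ 2 * (d%:R ^+ n * expR (- (r ^+ 2 * d%:R / (18 / 5 * n%:R)))) :> R.
Proof.
move=> d1 n0 r0 lamE lam5 rS.
pose U (c : 'Z_d) :=
  [set a : 'rV['Z_d]_n | r < `|(occ a c)%:R - n%:R / d%:R|]%SET.
apply: le_trans (_ : #|\bigcup_(c | c != 0%R) U c|%SET%:R <= _).
  rewrite ler_nat; apply/subset_leq_card/fintype.subsetP => a.
  rewrite inE negb_forall => /existsP[c]; rewrite negb_imply => /andP[c0 ac].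
  apply/bigcupP; exists c => //; rewrite inE ltNge; apply: contra ac.
  by apply: rS; rewrite -[leqRHS]card_ord max_card.
apply: le_trans (_ : \sum_(c : 'Z_d | c != 0) #|U c|%:R <= _).
  rewrite -natr_sum ler_nat.
  apply: (big_ind2 (fun (A : {set _}) k => #|A| <= k)%N).
  - by rewrite cards0.
  - move=> A k B l Ak Bl; exact: leq_trans (leq_card_setU _ _) (leq_add Ak Bl).
  - by [].
apply: le_trans
  (ler_sum _ (fun c _ => card_occ_deviation d1 c n0 lamE r0 lam5)) _.
rewrite sumr_const -mulrA -mulrnAl ler_wpM2r ?mulr_ge0 ?expR_ge0 ?exprn_ge0 //.
rewrite -natrX -mulrnA ler_nat (_ : #|_| = d.-1); last first.
  by rewrite -[in RHS](Zp_cast d1); have := cardC1 (0 : 'Z_d); rewrite card_ord.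
by nia.
Qed.

Lemma expR_6_5 (R : realType) : expR (6 / 5) <= 4 :> R.
Proof.
have h : expR (1 / 5) <= 31 / 25 :> R.
  by apply: le_trans (expR_le_quadratic _) _; rewrite ?ger0_norm; lra.
rewrite (_ : 6 / 5 = 1 / 5 * 6%:R); last by field.
rewrite expRM_natr; apply: le_trans (_ : (31 / 25) ^+ 6 <= _); last first.
  by rewrite !exprS expr0; lra.
by rewrite lerXn2r // nnegrE ?expR_ge0 // divr_ge0.
Qed.

(** This combines [4 (d - 1) <= d^2], which is [(d - 2)^2 >= 0], with [expR (6 / 5) <= 4]. *)
Lemma ln_natr_lower_bound (R : realType) (d : nat) : (1 < d)%N ->
  3 / 5 + ln (d.-1%:R : R) / 2 <= ln d%:R.
Proof.
move=> d1; have d0 : 0 < d%:R :> R by rewrite ltr0n ltnW.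
have d'0 : 0 < d.-1%:R :> R by rewrite ltr0n -ltnS prednK // ltnW.
suff : 6 / 5 + ln (d.-1%:R : R) <= ln (d%:R ^+ 2).
  by rewrite lnXn // mulr2n; lra.
apply: le_trans (_ : ln (4 * d.-1%:R) <= _).
  by rewrite lnM ?posrE // lerD2r -ler_expR lnK ?posrE ?expR_6_5.
rewrite ler_ln ?posrE ?mulr_gt0 ?exprn_gt0 //.
have -> : (d.-1%:R : R) = d%:R - 1 by rewrite -subn1 natrB // ltnW.
by have := sqr_ge0 (d%:R - 2 : R); lra.
Qed.

(** Use the weight [q = eps / (10 (d - 1))] and write [l = ln (1 / eps)]. The factor
    [(1 + (d - 1) q)^n] costs at most [eps n / 10] in the exponent, and [q^(-m)] costs at most
    [eps n (1/2 + ln (d - 1) / 3)]. The total is below [eps n (3/5 + ln (d - 1) / 2)], hence below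
    [eps n ln d]. *)
Lemma hamming_ball_le (R : realType) (d n m : nat) (eps : R) :
  (1 < d)%N -> 0 < eps -> eps < 1 / 100 ->
  m%:R <= eps * n%:R / (3 * ln (1 / eps)) ->
  #|[set x : 'rV['Z_d]_n | (hamming x <= m)%N]%SET|%:R <= (d ^ n)%N%:R `^ eps.
Proof.
move=> d1 e0 e1 mM; set l := ln (1 / eps) in mM.
have d0 : 0 < d%:R :> R by rewrite ltr0n ltnW.
have d'0 : 0 < d.-1%:R :> R by rewrite ltr0n -ltnS prednK // ltnW.
have d'1 : 1 <= d.-1%:R :> R by rewrite ler1n -ltnS prednK // ltnW.
(* The bound [eps < 1 / 100] enters here: it gives [l + ln 10 <= 3/2 l]. *)
have l100 : ln 10 + ln 10 <= l.
  rewrite -lnM ?posrE // ler_ln ?posrE ?divr_gt0 // ler_pdivlMr //; lra.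
have l1 : 1 <= ln 10 :> R.
  rewrite -ler_expR lnK ?posrE //.
  apply: le_trans (_ : expR (6 / 5) <= _); first by rewrite ler_expR; lra.
  by have := expR_6_5 R; lra.
pose q := eps / 10 / d.-1%:R.
have q0 : 0 < q by rewrite !divr_gt0.
have q1 : q <= 1 by rewrite ler_pdivrMr //; lra.
apply: le_trans (card_hamming_ball n d1 m q0 q1) _.
have -> : (d ^ n)%N%:R `^ eps = expR (eps * n%:R * ln d%:R).
  rewrite natrX /powR expf_eq0 gt_eqF // andbF lnXn //; congr expR.
  by rewrite -mulr_natl; ring.
have qE : q = expR (- (l + ln 10 + ln d.-1%:R)).
  rewrite -!addrA opprD opprD !expRD !expRN !lnK ?posrE ?divr_gt0 //.
  by rewrite /q; field; rewrite !gt_eqF.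
have h1 : (1 + d.-1%:R * q) ^+ n <= expR (eps / 10 * n%:R).
  rewrite (_ : d.-1%:R * q = eps / 10); last by rewrite /q; field; rewrite gt_eqF.
  rewrite expRM_natr lerXn2r ?nnegrE ?expR_ge0 ?expR_ge1Dx //; lra.
apply: le_trans (ler_wpM2l _ h1) _; first by rewrite invr_ge0 exprn_ge0 // ltW.
rewrite qE -expRM_natr -expRN -expRD ler_expR.
have lnd' : 0 <= ln (d.-1%:R : R) by apply: ln_ge0.
apply: le_trans (_ : eps * n%:R * (3 / 5 + ln d.-1%:R / 2) <= _); last first.
  by rewrite ler_wpM2l ?ln_natr_lower_bound // mulr_ge0 // ltW.
set M := eps * n%:R / (3 * l) in mM.
have l0 : 0 < l by lra.
have Ml : M * l = eps * n%:R / 3 by rewrite /M; field; rewrite gt_eqF.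
have M0 : 0 <= M by apply: le_trans mM.
have Ml' : M <= eps * n%:R / 3 by rewrite -Ml ler_peMr //; lra.
have : m%:R * (l + ln 10 + ln d.-1%:R) <= M * (3 / 2 * l + ln d.-1%:R).
  by apply: ler_pM => //; lra.
have := ler_wpM2r lnd' Ml'.
have : 0 <= eps * n%:R * ln d.-1%:R by rewrite !mulr_ge0 // ltW.
by rewrite [M * (_ + _)]mulrDr mulrCA Ml; lra.
Qed.

Theorem theorem3p1 (R : realType) (d n : nat) (eps : R)
    (hd : (2 <= d)%N) (hn : (0 < n)%N)
    (heps0 : 0 < eps) (heps1 : eps < 1 / 100)
    (hpsi : 1 / psi d eps <= n%:R) :
  (rigidity (walsh_hadamard R d n)
     (powR_ge0 ((d ^ n)%N%:R : R) (1 - psi d eps)))%:R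
    <= ((d ^ n)%N%:R : R) `^ eps.
Proof.
have d0 : 0 < d%:R :> R by rewrite ltr0n ltnW.
have n0 : 0 < n%:R :> R by rewrite ltr0n.
have lnd0 : 0 < ln d%:R :> R by rewrite ln_gt0 // ltr1n.
set l := ln (1 / eps).
have l1 : 1 <= l.
  rewrite -ler_expR lnK ?posrE ?divr_gt0 //.
  apply: le_trans (_ : expR (6 / 5) <= _); first by rewrite ler_expR; lra.
  apply: le_trans (expR_6_5 R) _; rewrite ler_pdivlMr //; lra.
have l0 : 0 < l by lra.
(* This makes [2 r d] equal to [eps n / (3 l)], the largest radius allowed by [hamming_ball_le]. *)
pose r := eps * n%:R / (6 * l * d%:R).
have r0 : 0 <= r by rewrite divr_ge0 ?mulr_ge0 ?ltW.
pose S := [seq s <- iota 0 n.+1 | `|s%:R - n%:R / d%:R| <= r].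
have uS : uniq S by rewrite filter_uniq ?iota_uniq.
(* A square root of [omega], as the quadratic twist requires. *)
pose z : R[i] := Complex (cos (pi / d%:R)) (sin (pi / d%:R)).
have z2 : z ^+ 2 = omega R d.
  by rewrite complex_cos_sin_expr /omega; congr (Complex (cos _) (sin _)); ring.
have [i j|A [B [MAB As Br]]] :=
  walsh_hadamard_decomposition (M := walsh_hadamard R d n) hd
    (omega_prim R hd) z2 uS.
  by rewrite mxE.
pose m := (d.-1 * (size S).-1)%N.
apply: le_trans (_ : #|[set x : 'rV['Z_d]_n | (hamming x <= m)%N]%SET|%:R <= _);
  last apply: (hamming_ball_le hd heps0 heps1).
(* By minimality it suffices to exhibit one decomposition whose sparsity is the size of the ball. *)
rewrite ler_nat /rigidity; case: ex_minnP => s _; apply; apply/asboolP.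
  exists A, B; split=> //; apply: le_trans (_ : _ <= _) _.
    by rewrite -(ler_nat R) in Br; exact: Br.
  apply: le_trans (card_unbalanced (r := r) hd hn r0 erefl _ _) _.
  - rewrite (_ : r * d%:R / _ = eps / (54 / 5 * l)).
      by rewrite ler_pdivrMr ?mulr_gt0 ?divr_gt0 //; lra.
    by rewrite /r; field; rewrite !gt_eqF.
  - by move=> s' s'n rs'; rewrite mem_filter rs' mem_iota.
  have lndE : expR (ln d%:R) = d%:R :> R by rewrite lnK.
  rewrite natrX /powR expf_eq0 gt_eqF // andbF lnXn //.
  rewrite -{1 2}lndE -!expRM_natr -!expRD ler_expR.
  (* The constant [1000 / 324] exceeds 3. One copy of [psi n ln d] yields the factor [N^(-psi)], and
     two more absorb [d ^ 2] because [psi n >= 1]. *)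
  have psiE : r ^+ 2 * d%:R / (18 / 5 * n%:R) =
      (1000 / 324) * (psi d eps * n%:R * ln d%:R).
    by rewrite /r /psi -/l; field; rewrite !gt_eqF.
  have psi0 : 0 < psi d eps by rewrite divr_gt0 ?mulr_gt0 ?exprn_gt0.
  have psin : ln d%:R <= psi d eps * n%:R * ln d%:R.
    by rewrite (ler_peMl (ltW lnd0)) //; move: hpsi; rewrite ler_pdivrMr // mulrC.
  by rewrite psiE -[ln _ *+ n]mulr_natr; lra.
rewrite natrM; apply: le_trans (_ : d%:R * (2 * r) <= _).
  rewrite ler_pM // ?ler_nat ?leq_pred //.
  apply: (size_uniq_near (x := n%:R / d%:R) r0 uS) => s.
  by rewrite mem_filter => /andP[].
by rewrite -/l /r le_eqVlt; apply/orP; left; apply/eqP; field; rewrite !gt_eqF.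
Qed.
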